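(* Let $k$ be an algebraically closed field of characteristic $p>0$ and let $(\mathfrak{g},[p])$ be a finite-dimensional restricted Lie algebra over $k$ such that $V(\mathfrak{g})=\{x\in\mathfrak{g} : x^{[p]}=0\}$ is a subspace of $\mathfrak{g}$. Let $j\in\{1,\ldots,p-1\}$ and let $M$ be a finite-dimensional $U_0(\mathfrak{g})$-module of constant $j$-rank. Then $M$ has the equal $j$-kernels property if and only if $\deg^j(M)=j\,\mathrm{rk}^j(M)$.
   Context: $U_0(\mathfrak{g})=U(\mathfrak{g})/(\{x^p-x^{[p]} : x\in\mathfrak{g}\})$ is the restricted enveloping algebra. For $x\in\mathfrak{g}$, $x_M:M\to M$ is the operator $m\mapsto x.m$. The generic $j$-rank is $\mathrm{rk}^j(M)=\max\{\mathrm{rk}(x_M^j) : x\in V(\mathfrak{g})\}$, and $M$ has constant $j$-rank if $\mathrm{rk}(x_M^j)=\mathrm{rk}(y_M^j)$ for all $x,y\in V(\mathfrak{g})\setminus\{0\}$. $M$ has the equal $j$-kernels property if there is a subspace $W_j\subseteq M$ with $\ker x_M^j=W_j$ for all $x\in V(\mathfrak{g})\setminus\{0\}$. Degree of a morphism: if $U\subseteq\mathbb{P}^n$ is non-empty open and $\varphi:U\to\mathbb{P}^m$ is a morphism, there are homogeneous polynomials $f_0,\ldots,f_m\in k[X_0,\ldots,X_n]$ of the same degree $d$ with $\gcd(f_0,\ldots,f_m)=1$ and $\varphi(x)=(f_0(x):\cdots:f_m(x))$ for all $x\in U$; they are unique up to a common non-zero scalar, and $\deg(\varphi):=d$. Degree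 of a module: let $d_j=\mathrm{rk}^j(M)$. The set $U_{M,j}=\{[x]\in\mathbb{P}(V(\mathfrak{g})) : \mathrm{rk}(x_M^j)=d_j\}$ is open, and $\mathrm{im}^j_M:U_{M,j}\to\mathrm{Gr}_{d_j}(M)$, $[x]\mapsto\mathrm{im}\,x_M^j$, is a morphism to the Grassmannian of $d_j$-dimensional subspaces of $M$. Let $\mathrm{pl}_M:\mathrm{Gr}_{d_j}(M)\to\mathbb{P}(\bigwedge^{d_j}M)$ be the Plücker embedding. The $j$-degree is $\deg^j(M):=\deg(\mathrm{pl}_M\circ\mathrm{im}^j_M)$ if $d_j>0$, and $\deg^j(M):=0$ if $d_j=0$.
   Formalization: The formal theorem additionally assumes dim V(g) ≠ 1; for dim V(g) = 1 the claim fails whenever rk^j(M) > 0 (e.g. g = kx, x^[p] = 0, M = k[x]/(x^p), j = 1: equal kernels hold, but deg^1(M) = 0 ≠ p−1), and is trivial when rk^j(M) = 0. *)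

(* Defs.v *)
From HB Require Import structures.
From mathcomp Require Import all_boot all_algebra.
From mathcomp Require Import boolp.
From mathcomp Require monalg.
From mathcomp Require Import mpoly.

Set Implicit Arguments.
Unset Strict Implicit.
Unset Printing Implicit Defensive.

Import GRing.Theory.
Local Open Scope ring_scope.

Record lieAlg (k : fieldType) := LieAlg {
  lie_car :> vectType k;
  bracket : lie_car -> lie_car -> lie_car;
  bracketDl : forall c x y z,
    bracket (c *: x + y) z = c *: bracket x z + bracket y z;
  bracketDr : forall c x y z,
    bracket z (c *: x + y) = c *: bracket z x + bracket z y;
  bracketxx : forall x, bracket x x = 0;
  jacobi : forall x y z,
    bracket x (bracket y z) + bracket y (bracket z x)
      + bracket z (bracket x y) = 0 }.

(* Coefficient of t^i in (ad(t x + y))^n (x), computed in g (x) k[t]. *)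
Fixpoint ad_coef (k : fieldType) (g : lieAlg k) (x y : g) (n i : nat) : g :=
  if n is n'.+1 then
    bracket y (ad_coef x y n' i)
      + (if i is i'.+1 then bracket x (ad_coef x y n' i') else 0)
  else if i == 0%N then x else 0.

(* The last axiom is Jacobson's formula
     (x + y)^[p] = x^[p] + y^[p] + \sum_(1 <= i < p) s_i(x, y),
   i * s_i(x, y) being the coefficient of t^(i-1) in (ad(t x + y))^(p-1) (x). *)
Record restrLieAlg (k : fieldType) (p : nat) := RestrLieAlg {
  restr_lie :> lieAlg k;
  restr_pchar : p \in [pchar k];
  ppow : restr_lie -> restr_lie;
  ppow_ad : forall x y, bracket (ppow x) y = iter p (bracket x) y;
  ppowZ : forall c x, ppow (c *: x) = c ^+ p *: ppow x;
  ppowD : forall x y,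
    ppow (x + y) = ppow x + ppow y
      + \sum_(1 <= i < p) (i%:R)^-1 *: ad_coef x y p.-1 i.-1 }.

Definition nullcone (k : fieldType) (p : nat) (g : restrLieAlg k p) : pred g :=
  fun x => ppow x == 0.

Inductive ideal_gen (R : nzRingType) (S : R -> Prop) : R -> Prop :=
| IdealGen0 : ideal_gen S 0
| IdealGenD a b : ideal_gen S a -> ideal_gen S b -> ideal_gen S (a + b)
| IdealGenM a s b : S s -> ideal_gen S (a * s * b).

Section IdealGen.
Variables (R : nzRingType) (S : R -> Prop).

Lemma ideal_genMl a x : ideal_gen S x -> ideal_gen S (a * x).
Proof.
elim=> [|b c _ hb _ hc|b s c hs]; first by rewrite mulr0; exact: IdealGen0.
  by rewrite mulrDr; apply: IdealGenD.
by rewrite !mulrA; apply: IdealGenM.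
Qed.

Lemma ideal_genMr a x : ideal_gen S x -> ideal_gen S (x * a).
Proof.
elim=> [|b c _ hb _ hc|b s c hs]; first by rewrite mul0r; exact: IdealGen0.
  by rewrite mulrDl; apply: IdealGenD.
by rewrite -mulrA; apply: IdealGenM.
Qed.

Definition ideal_pred : {pred R} := fun x : R => `[< ideal_gen S x >].

Lemma ideal_pred_zmod : zmod_closed ideal_pred.
Proof.
split; first by apply/asboolP; exact: IdealGen0.
move=> x y /asboolP hx /asboolP hy; apply/asboolP; apply: IdealGenD => //.
by rewrite -mulN1r; apply: ideal_genMl.
Qed.
HB.instance Definition _ := GRing.isZmodClosed.Build R ideal_pred ideal_pred_zmod.

Lemma ideal_predMl a x : x \in ideal_pred -> a * x \in ideal_pred.
Proof. by move=> /asboolP h; apply/asboolP/ideal_genMl. Qed.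

Lemma ideal_predMr a x : x \in ideal_pred -> x * a \in ideal_pred.
Proof. by move=> /asboolP h; apply/asboolP/ideal_genMr. Qed.

End IdealGen.

Section QuotAlg.
Local Open Scope quotient_scope.
Variables (k : fieldType) (A : lalgType k) (S : A -> Prop).

(* The proof that the ideal is proper is a parameter because the library's
   algebras are non-trivial rings. *)
Definition quotalg (_ : ~ ideal_gen S 1) : Type :=
  Quotient.quot (ideal_pred S).

Variable S1 : ~ ideal_gen S 1.
Local Notation Q := (quotalg S1).
Local Notation I := (ideal_pred S).

HB.instance Definition _ := GRing.Zmodule.copy Q (Quotient.quot I).

Definition quot_pi (a : A) : Q := \pi_(Quotient.quot I) a.
Definition quot_repr (x : Q) : A := repr (x : Quotient.quot I).

Lemma quot_reprK : cancel quot_repr quot_pi.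
Proof. exact: reprK. Qed.

Lemma quot_piE a b : quot_pi a = quot_pi b <-> a - b \in I.
Proof.
rewrite /quot_pi Quotient.idealrBE; split=> [->|/eqP//]; exact: eqxx.
Qed.

Lemma quot_repr_pi a : quot_repr (quot_pi a) - a \in I.
Proof. by apply/quot_piE; rewrite quot_reprK. Qed.

Lemma quot_piD : {morph quot_pi : a b / a + b}.
Proof. exact: (Quotient.pi_add I). Qed.

Lemma quot_pi0 : quot_pi 0 = 0.
Proof. by apply: (addrI (quot_pi 0)); rewrite -quot_piD !addr0. Qed.

Definition quot_one : Q := quot_pi 1.
Definition quot_mul (x y : Q) : Q := quot_pi (quot_repr x * quot_repr y).
Definition quot_scale (c : k) (x : Q) : Q := quot_pi (c *: quot_repr x).

Lemma quot_piM a b : quot_pi (a * b) = quot_mul (quot_pi a) (quot_pi b).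
Proof.
apply/esym/quot_piE; set a' := quot_repr _; set b' := quot_repr _.
rewrite -[a' * b'](subrK (a' * b)) -addrA -mulrBr -mulrBl rpredD //.
  exact/ideal_predMl/quot_repr_pi.
exact/ideal_predMr/quot_repr_pi.
Qed.

Lemma quot_piZ c a : quot_pi (c *: a) = quot_scale c (quot_pi a).
Proof.
apply/esym/quot_piE; rewrite -scalerBr -[_ - a]mul1r scalerAl.
exact/ideal_predMl/quot_repr_pi.
Qed.

Lemma quot_mulA : associative quot_mul.
Proof.
move=> x y z; rewrite -[x]quot_reprK -[y]quot_reprK -[z]quot_reprK.
by rewrite -!quot_piM mulrA.
Qed.

Lemma quot_mul1l : left_id quot_one quot_mul.
Proof. by move=> x; rewrite -[x]quot_reprK -quot_piM mul1r. Qed.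

Lemma quot_mul1r : right_id quot_one quot_mul.
Proof. by move=> x; rewrite -[x]quot_reprK -quot_piM mulr1. Qed.

Lemma quot_mulDl : left_distributive quot_mul +%R.
Proof.
move=> x y z; rewrite -[x]quot_reprK -[y]quot_reprK -[z]quot_reprK.
by rewrite -quot_piD -!quot_piM mulrDl quot_piD.
Qed.

Lemma quot_mulDr : right_distributive quot_mul +%R.
Proof.
move=> x y z; rewrite -[x]quot_reprK -[y]quot_reprK -[z]quot_reprK.
by rewrite -quot_piD -!quot_piM mulrDr quot_piD.
Qed.

Lemma quot_one_neq0 : quot_one != 0.
Proof.
apply/eqP; rewrite -quot_pi0 => /quot_piE; rewrite subr0.
by move=> /asboolP; apply: S1.
Qed.

HB.instance Definition _ := GRing.Zmodule_isNzRing.Build Q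
  quot_mulA quot_mul1l quot_mul1r quot_mulDl quot_mulDr quot_one_neq0.

Lemma quot_scaleA a b x :
  quot_scale a (quot_scale b x) = quot_scale (a * b) x.
Proof. by rewrite -[x]quot_reprK -!quot_piZ scalerA. Qed.

Lemma quot_scale1 : left_id 1 quot_scale.
Proof. by move=> x; rewrite -[x]quot_reprK -quot_piZ scale1r. Qed.

Lemma quot_scaleDr : right_distributive quot_scale +%R.
Proof.
move=> c x y; rewrite -[x]quot_reprK -[y]quot_reprK.
by rewrite -quot_piD -!quot_piZ scalerDr quot_piD.
Qed.

Lemma quot_scaleDl x : {morph quot_scale^~ x : a b / a + b}.
Proof.
by move=> a b; rewrite -[x]quot_reprK -!quot_piZ scalerDl quot_piD.
Qed.

HB.instance Definition _ := GRing.Zmodule_isLmodule.Build k Q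
  quot_scaleA quot_scale1 quot_scaleDr quot_scaleDl.

Lemma quot_scaleAl (c : k) (x y : Q) : c *: (x * y) = c *: x * y.
Proof.
have Mpi a b : quot_pi a * quot_pi b = quot_pi (a * b) by rewrite quot_piM.
have Zpi a : c *: quot_pi a = quot_pi (c *: a) by rewrite quot_piZ.
by rewrite -[x]quot_reprK -[y]quot_reprK !(Mpi, Zpi) scalerAl.
Qed.

HB.instance Definition _ := GRing.Lmodule_isLalgebra.Build k Q quot_scaleAl.

End QuotAlg.

(* An augmentation killing S shows that the ideal generated by S is proper
   and descends to the quotient. *)
Section Augmentation.
Variables (k : fieldType) (A : lalgType k) (S : A -> Prop) (e : A -> k).

Definition is_aug :=
  [/\ e 1 = 1, {morph e : a b / a + b} & {morph e : a b / a * b}].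

Hypotheses (e_aug : is_aug) (eS : forall s, S s -> e s = 0).

Lemma aug_ideal a : ideal_gen S a -> e a = 0.
Proof.
case: e_aug => _ eD eM.
elim=> [|x y _ hx _ hy|x s y hs]; last by rewrite !eM (eS hs) mulr0 mul0r.
  by apply: (addrI (e 0)); rewrite -eD !addr0.
by rewrite eD hx hy addr0.
Qed.

Lemma aug_proper : ~ ideal_gen S 1.
Proof.
by case: e_aug => e1 _ _ /aug_ideal; rewrite e1 => /eqP; rewrite oner_eq0.
Qed.

Variable S1 : ~ ideal_gen S 1.
Definition quot_aug (x : quotalg S1) : k := e (quot_repr x).

Lemma quot_aug_pi a : quot_aug (quot_pi S1 a) = e a.
Proof.
case: e_aug => _ eD _; rewrite /quot_aug -[quot_repr _](subrK a) eD.
by rewrite aug_ideal ?add0r //; apply/asboolP/quot_repr_pi.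
Qed.

Lemma quot_aug_is_aug :
  [/\ quot_aug 1 = 1, {morph quot_aug : a b / a + b}
    & {morph quot_aug : a b / a * b}].
Proof.
case: e_aug => e1 eD eM; split; first by rewrite quot_aug_pi.
  move=> x y; rewrite -[x]quot_reprK -[y]quot_reprK.
  by rewrite -quot_piD !quot_aug_pi eD.
move=> x y; rewrite -[x]quot_reprK -[y]quot_reprK.
by rewrite -[_ * _]quot_piM !quot_aug_pi eM.
Qed.
End Augmentation.

(* monalg is imported locally: its notations shadow those of mpoly. *)
Module Enveloping.
Import monalg.

Section Universal.
Variables (k : fieldType) (g : lieAlg k).

(* Free associative algebra on the underlying set of g; the tensor algebra of
   g is its quotient by the relations EnvLinear. *)
Definition freealg : lalgType k := {malg k[{fmonom g}]}.

Definition free_gen (x : g) : freealg := mkmalgU (fmu x) 1.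

Inductive env_rel : freealg -> Prop :=
| EnvLinear c x y :
    env_rel (free_gen (c *: x + y) - (c *: free_gen x + free_gen y))
| EnvBracket x y :
    env_rel (free_gen x * free_gen y - free_gen y * free_gen x
             - free_gen (bracket x y)).

Definition free_aug (a : freealg) : k := mcoeff (mone : {fmonom g}) a.

Lemma free_aug_is_aug : is_aug free_aug.
Proof.
split; [exact: rmorph1 | exact: raddfD | exact: rmorphM].
Qed.

Lemma free_aug_gen x : free_aug (free_gen x) = 0.
Proof.
rewrite /free_aug /free_gen mcoeffU; case: eqP => // /(congr1 val).
by rewrite /= /fmu /= fmE fm1.
Qed.

Lemma free_aug_rel s : env_rel s -> free_aug s = 0.
Proof.
have eB a b : free_aug (a - b) = free_aug a - free_aug b by exact: raddfB.
have eZ c a : free_aug (c *: a) = c * free_aug a by exact: mcoeffZ.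
case: free_aug_is_aug => _ eD eM [c x y|x y].
  by rewrite eB eD eZ !free_aug_gen mulr0 addr0 subr0.
by rewrite !eB !eM !free_aug_gen mul0r !subr0.
Qed.

Definition env_proper : ~ ideal_gen env_rel 1 :=
  aug_proper free_aug_is_aug free_aug_rel.

Definition universal_env : lalgType k := quotalg env_proper.

Definition env_iota (x : g) : universal_env := quot_pi env_proper (free_gen x).

Definition env_aug (u : universal_env) : k := quot_aug free_aug u.

Lemma env_aug_is_aug : is_aug env_aug.
Proof. exact: quot_aug_is_aug free_aug_is_aug free_aug_rel _. Qed.

Lemma env_aug_iota x : env_aug (env_iota x) = 0.
Proof.
rewrite /env_aug /env_iota (quot_aug_pi free_aug_is_aug free_aug_rel).
exact: free_aug_gen.
Qed.

End Universal.

Section Restricted.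
Variables (k : fieldType) (p : nat) (g : restrLieAlg k p).

Inductive restr_rel : universal_env g -> Prop :=
| RestrRel x : restr_rel (env_iota x ^+ p - env_iota (ppow x)).

Lemma env_aug_restr_rel s : restr_rel s -> env_aug s = 0.
Proof.
case: (env_aug_is_aug g) => e1 eD eM [x].
have p0 : (0 < p)%N by case/andP: (restr_pchar g) => /prime_gt0.
have e0 : env_aug (0 : universal_env g) = 0.
  by apply: (addrI (env_aug (0 : universal_env g))); rewrite -eD !addr0.
have eN a : env_aug (- a : universal_env g) = - env_aug a.
  by apply: (addrI (env_aug a)); rewrite -eD !subrr.
have eX n : (0 < n)%N -> env_aug (env_iota x ^+ n) = 0.
  by case: n => // n _; rewrite exprS eM env_aug_iota mul0r.
by rewrite eD eN eX // env_aug_iota subr0.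
Qed.

Definition restr_proper : ~ ideal_gen restr_rel 1 :=
  aug_proper (env_aug_is_aug g) env_aug_restr_rel.

Definition restricted_env : lalgType k := quotalg restr_proper.

Definition restr_iota (x : g) : restricted_env :=
  quot_pi restr_proper (env_iota x).

End Restricted.
End Enveloping.
Export Enveloping.

Record fdModule (k : fieldType) (A : lalgType k) := FdModule {
  mod_car :> vectType k;
  mod_act : A -> 'End(mod_car);
  mod_act_linear : linear mod_act;
  mod_act1 : mod_act 1 = \1%VF;
  mod_actM : forall a b, mod_act (a * b) = (mod_act a \o mod_act b)%VF }.

Section ModuleInvariants.
Variables (k : fieldType) (p : nat) (g : restrLieAlg k p).
Variable M : fdModule (restricted_env g).
Implicit Types (x y : g) (j : nat).

(* x_M ^ j *)
Definition op_pow x j : 'End(M) :=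
  iter j (fun f => (mod_act M (restr_iota x) \o f)%VF) \1%VF.

Definition op_rank x j : nat := \dim (limg (op_pow x j)).

Definition generic_rank j : nat :=
  \max_(r < (\dim {:M}).+1 |
          `[< exists2 x, x \in nullcone (g := g) & op_rank x j = r >]) r.

Definition constant_rank j : Prop :=
  forall x y, x \in nullcone (g := g) -> x != 0 ->
              y \in nullcone (g := g) -> y != 0 -> op_rank x j = op_rank y j.

Definition equal_kernels j : Prop :=
  exists W : {vspace M}, forall x,
    x \in nullcone (g := g) -> x != 0 -> lker (op_pow x j) = W.

End ModuleInvariants.

Definition Gr (k : fieldType) (V : vectType k) (d : nat) :=
  {W : {vspace V} | \dim W == d}.

Definition PP (k : fieldType) (V : vectType k) := Gr V 1.

Section MorphismDegree.
Variables (k : fieldType) (V W : vectType k).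

(* Homogeneous coordinates on P(V) and P(W) are those of the bases
   vbasis {:V} and vbasis {:W}; the degree does not depend on the bases. *)
Definition poly_eval (f : 'I_(\dim {:W}) -> {mpoly k[\dim {:V}]}) (x : V) : W :=
  \sum_i (f i).@[fun l => coord (vbasis {:V}) l x] *: (vbasis {:W})`_i.

(* gcd (f_0, ..., f_m) = 1 *)
Definition gcd1 n m (f : 'I_m -> {mpoly k[n]}) : Prop :=
  forall h, (forall i, exists q, f i = q * h) -> h \is a GRing.unit.

Variables (U : pred (PP V)) (phi : {L : PP V | U L} -> PP W).

Definition has_degree (d : nat) : Prop :=
  exists f : 'I_(\dim {:W}) -> {mpoly k[\dim {:V}]},
    [/\ forall i, f i \is d.-homog,
        gcd1 f
      & forall (L : {L : PP V | U L}) (x : V),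
          x \in sval (sval L) -> x != 0 ->
          sval (phi L) = <[poly_eval f x]>%VS].

(* has_degree is satisfied by exactly one d when phi is a morphism on a
   non-empty open set U; 0 is only a default value. *)
Definition morph_degree : nat :=
  if pselect (exists d, has_degree d) is left h then sval (cid h) else 0%N.

End MorphismDegree.

Section Plucker.
Variables (k : fieldType) (M : vectType k) (d : nat).
Local Notation n := (\dim {:M}).

Definition subsets := {I : {set 'I_n} | #|I| == d}.

(* The exterior power is modelled by its basis e_I = e_{i_1} /\ ... /\ e_{i_d},
   for I = {i_1 < ... < i_d}, with e = vbasis {:M}; the e_I-coordinate of
   w_1 /\ ... /\ w_d is the minor of the coordinates of the w_a at I. *)
Definition extpow : vectType k := {ffun subsets -> k^o}.

Definition subset_nth (I : subsets) (b : 'I_d) : 'I_n :=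
  enum_val (cast_ord (esym (eqP (svalP I))) b).

Definition wedge (w : 'I_d -> M) : extpow :=
  [ffun I => \det (\matrix_(a < d, b < d)
                      coord (vbasis {:M}) (subset_nth I b) (w a))].

Lemma wedge_neq0 (W : Gr M d) : wedge (fun a => (vbasis (sval W))`_a) != 0.
Proof.
case: W => W /= /eqP dW; set w := fun a : 'I_d => _.
pose A := \matrix_(a < d, i < n) coord (vbasis {:M}) i (w a).
have fA : row_full A^T.
  rewrite /row_full mxrank_tr -[_ == d]/(row_free A) -kermx_eq0.
  apply/rowV0P => v /sub_kermxP vA.
  have : \sum_a v 0 a *: w a = 0.
    transitivity (\sum_i (v *m A) 0 i *: (vbasis {:M})`_i); last first.
      by rewrite vA big1 // => i _; rewrite mxE scale0r.
    under [RHS]eq_bigr do rewrite mxE scaler_suml.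
    rewrite exchange_big /=; apply: eq_bigr => a _.
    rewrite {1}(coord_vbasis (memvf (w a))) scaler_sumr.
    by apply: eq_bigr => i _; rewrite mxE scalerA.
  move=> v0; apply/rowP => a; rewrite mxE.
  have /freeP/(_ (fun i => v 0 (cast_ord dW i))) := basis_free (vbasisP W).
  rewrite (reindex (cast_ord dW)) /= in v0; last first.
    by apply: onW_bij; exists (cast_ord (esym dW)) => i;
      rewrite ?cast_ordK ?cast_ordKV.
  by move=> /(_ v0 (cast_ord (esym dW) a)); rewrite cast_ordKV.
pose f := fullrankfun fA.
have cI : #|f @: 'I_d| == d.
  by rewrite card_imset ?card_ord //; apply: fullrankfun_inj.
pose I : subsets := exist _ (f @: 'I_d) cI.
pose B := \matrix_(a < d, b < d) A a (subset_nth I b).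
suff uB : B^T \in unitmx.
  apply/eqP => /ffunP/(_ I); rewrite !ffunE => /eqP; apply/negP.
  rewrite unitmx_tr unitmxE unitfE in uB; apply: contraNneq uB => <-.
  by apply/eqP; congr (\det _); apply/matrixP => a b; rewrite !mxE.
rewrite -row_full_unit -sub1mx.
apply: (submx_trans (_ : _ <= rowsub f A^T)%MS).
  by rewrite sub1mx; apply: fullrowsub_full.
apply/row_subP => a.
have fI : f a \in f @: 'I_d by apply: imset_f.
pose b := cast_ord (eqP cI) (enum_rank_in fI (f a)).
suff -> : row a (rowsub f A^T) = row b B^T by exact: row_sub.
apply/rowP => c; rewrite !mxE; congr (coord _ _ _).
rewrite /subset_nth /b (_ : cast_ord _ _ = enum_rank_in fI (f a)).
  by rewrite enum_rankK_in.
by apply/val_inj.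
Qed.

Lemma plucker_subproof (W : Gr M d) :
  \dim <[wedge (fun a => (vbasis (sval W))`_a)]> == 1%N.
Proof. by rewrite dim_vline wedge_neq0. Qed.

Definition plucker (W : Gr M d) : PP extpow := 
  exist (fun L : {vspace extpow} => \dim L == 1%N) _ (plucker_subproof W).

End Plucker.

(* V is meant to be the subspace of g whose elements are those of the
   nullcone. The image of x_M^j only depends on the line spanned by x, so it
   is read off at vpick L, a non-zero vector of the line L. *)
Section ModuleDegree.
Variables (k : fieldType) (p : nat) (g : restrLieAlg k p) (V : {vspace g}).
Variables (M : fdModule (restricted_env g)) (j : nat).

Definition line_im (L : PP (subvs_of V)) : {vspace M} :=
  limg (op_pow M (vsval (vpick (sval L))) j).

Definition max_locus : pred (PP (subvs_of V)) :=
  fun L => \dim (line_im L) == generic_rank M j.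

Definition im_map (L : {L | max_locus L}) : Gr M (generic_rank M j) :=
  exist (fun W : {vspace M} => \dim W == generic_rank M j) _ (svalP L).

Definition mod_degree : nat :=
  if generic_rank M j == 0%N then 0%N
  else morph_degree (fun L => plucker (im_map L)).

End ModuleDegree.

(* Main.v *)
Require Import Defs.
From HB Require Import structures.
From mathcomp Require Import all_boot all_algebra.
From mathcomp Require Import boolp mpoly.

Set Implicit Arguments.
Unset Strict Implicit.
Unset Printing Implicit Defensive.

Import GRing.Theory.
Local Open Scope ring_scope.

(** Let [d] be the generic [j]-rank.  For fixed vectors [v_1, ..., v_d] of [M],
    the wedge of the [x_M^j v_a] is given by forms of degree [j d] in [x], and
    it lies on the Pluecker line of [im x_M^j].  If the kernels all equal [W],
    taking the [v_a] to span a complement of [W] yields forms without common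
    zero, so the degree is [j d].  Conversely, if the Pluecker map is given by
    forms [f] of degree [j d], each such wedge is a multiple of [f] by a
    constant independent of [x]; hence its vanishing does not depend on [x],
    and neither does the kernel, which consists of the [u] such that every
    wedge with [v_1 = u] vanishes.

    Constant rank means that the Pluecker map is defined at every point, so the
    representing forms never vanish simultaneously off the origin.  All
    statements about multivariate forms (coprimality, proportionality,
    uniqueness of the degree) can then be checked on lines missing the origin,
    where they concern univariate polynomials. *)

(** * Univariate polynomials over an algebraically closed field *)

Section ClosedFieldPoly.
Variable k : closedFieldType.
Implicit Types (p q : {poly k}).

(** If [p] were non-zero, [p * 'X + 1] would be non-constant and so have a root, although its value
    there is 1. *)
Lemma horner_eq0_poly p : (forall t, p.[t] = 0) -> p = 0.
Proof.
move=> p0; apply/eqP/negPn/negP => nzp.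
suff /closed_rootP[t] : size (p * 'X + 1) != 1%N.
  by rewrite /root !hornerE p0 mul0r add0r oner_eq0.
rewrite size_addl size_mulX // ?size_poly1 ?ltnS ?size_poly_gt0 //.
by rewrite eqSS size_poly_eq0.
Qed.

Lemma no_root_polyC p : (forall t, p.[t] != 0) -> exists c, p = c%:P.
Proof.
move=> p0.
have /eqP s1 : size p == 1%N.
  by apply/negPn/negP => /closed_rootP[t]; apply/negP/p0.
by exists p`_0; apply: size1_polyC; rewrite s1.
Qed.

(** Linear factors are cancelled one at a time: a root [t] of [p] is not a root of some [F i], hence
    it is a root of [q]. *)
Lemma dvdp_no_common_root (I : Type) (F : I -> {poly k}) p q :
    (forall t, exists i, (F i).[t] != 0) -> p != 0 ->
  (forall i, p %| q * F i) -> p %| q.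
Proof.
move=> F0; have [n] := ubnP (size p); elim: n p q => // n IHn p q ltpn nzp pqF.
have [/eqP/size_poly1P[c nzc ->]|] := eqVneq (size p) 1%N.
  by rewrite -alg_polyC dvdpZl // dvd1p.
case/closed_rootP=> t /factor_theorem[p' Dp].
have nzX : 'X - t%:P != 0 :> {poly k} by rewrite polyXsubC_eq0.
have nzp' : p' != 0 by apply: contraNneq nzp => p'0; rewrite Dp p'0 mul0r.
have [i Fit] := F0 t.
have /factor_theorem[q' Dq] : root q t.
  have := pqF i; rewrite Dp => /(dvdp_trans (dvdp_mull _ (dvdpp _))).
  by rewrite dvdp_XsubCl rootM [root (F i) t]/root (negPf Fit) orbF.
rewrite Dp Dq dvdp_mul2r //; apply: IHn => // [|l].
  by move: ltpn; rewrite Dp size_Mmonic ?monicXsubC // size_XsubC addn2.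
by have := pqF l; rewrite Dp Dq mulrAC dvdp_mul2r.
Qed.

(** The products [G i * F l] and [G l * F i] agree at every point, hence are equal. So [F i0]
    divides every [G i0 * F l], and therefore [G i0] itself; the quotient is the common factor. *)
Lemma proportional_poly n (F G : 'I_n -> {poly k}) :
    (forall t, exists i, (F i).[t] != 0) ->
    (forall t, exists c, forall i, (G i).[t] = c * (F i).[t]) ->
  exists c, forall i, G i = c * F i.
Proof.
move=> F0 GF; have [i0 Fi0] := F0 0.
have nzF : F i0 != 0 by apply: contraNneq Fi0 => ->; rewrite horner0.
have cross i l : G i * F l = G l * F i.
  apply/eqP; rewrite -subr_eq0; apply/eqP/horner_eq0_poly => t.
  have [c Dc] := GF t; rewrite hornerD hornerN !hornerM !Dc.
  by rewrite mulrAC subrr.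
have /dvdpP[c Dc] : F i0 %| G i0.
  by apply: (dvdp_no_common_root F0) => // i; rewrite -cross dvdp_mull.
exists c => i; apply: (mulIf nzF).
by rewrite cross Dc mulrAC.
Qed.

End ClosedFieldPoly.

(** * Multivariate polynomials as functions *)

Section Kronecker.

(** Uniqueness of base-[N] digits: reduction modulo [N] isolates the digit at 0, and induction
    handles the quotient. *)
Lemma digits_inj N n (a b : 'I_n -> nat) :
    (forall i, a i < N)%N -> (forall i, b i < N)%N ->
  (\sum_i a i * N ^ i = \sum_i b i * N ^ i)%N -> a =1 b.
Proof.
elim: n a b => [|n IHn] a b ltaN ltbN; first by move=> _ [].
have N0 : (0 < N)%N by exact: leq_ltn_trans (ltaN ord0).
rewrite !big_ord_recl /= !expn0 !muln1.
have E (c : 'I_n.+1 -> nat) : (\sum_(i < n) c (lift ord0 i) * N ^ bump 0 i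
    = (\sum_(i < n) c (lift ord0 i) * N ^ i) * N)%N.
  by rewrite big_distrl; apply: eq_bigr => i _; rewrite /= expnSr mulnA.
rewrite !E => eqab.
have eq0 : a ord0 = b ord0.
  by have := congr1 (modn^~ N) eqab; rewrite /= ![(_ + _ * N)%N]addnC !modnMDl !modn_small.
move/eqP: eqab; rewrite eq0 eqn_add2l eqn_pmul2r // => /eqP eqab i.
case: (unliftP ord0 i) => [i'|] -> //.
exact: (IHn (fun i => a (lift ord0 i)) (fun i => b (lift ord0 i))).
Qed.

(* Kronecker's substitution 'X_i := t ^ (N ^ i), with N larger than every
   exponent, keeps distinct monomials distinct. *)
Lemma meval_eq0_mpoly (k : closedFieldType) n (f : {mpoly k[n]}) :
  (forall v, f.@[v] = 0) -> f = 0.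
Proof.
move=> f0; apply/mpolyP => m0; rewrite mcoeff0.
have [m0f|] := boolP (m0 \in msupp f); last exact: memN_msupp_eq0.
pose N := msize f.
pose e (m : 'X_{1..n}) := (\sum_i m i * N ^ i)%N.
have ltN m i : m \in msupp f -> (m i < N)%N.
  move=> mf; apply: leq_ltn_trans (msize_mdeg_lt mf).
  by rewrite mdegE (bigD1 i) //= leq_addr.
pose P := \sum_(m <- msupp f) f@_m *: 'X^(e m).
have P0 : P = 0.
  apply: horner_eq0_poly => t; rewrite -[RHS](f0 (fun i => t ^+ (N ^ i))).
  rewrite horner_sum mevalE; apply: eq_bigr => m _.
  rewrite !hornerE expr_sum; congr (_ * _); apply: eq_bigr => i _.
  by rewrite mulnC exprM.
have := congr1 (fun q : {poly k} => q`_(e m0)) P0.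
rewrite coef0 coef_sum (bigD1_seq m0) //= big_seq_cond big1 ?addr0.
  by rewrite coefZ coefXn eqxx mulr1.
move=> m /andP[mf ne]; rewrite coefZ coefXn; case: eqP => [eqe|]; last first.
  by rewrite mulr0.
case/eqP: ne; apply/mnmP => i.
by symmetry; apply: digits_inj eqe i => i; apply: ltN.
Qed.
End Kronecker.

(** * Restriction of multivariate polynomials to lines *)

Section LinePoly.
Variables (k : fieldType) (n : nat) (a b : 'I_n -> k).

(** This is [f] pulled back along [t |-> a + t b], expanded over monomials so that degree and top
    coefficient can be computed factor by factor. *)
Definition line_poly (f : {mpoly k[n]}) : {poly k} :=
  \sum_(m <- msupp f) f@_m *: \prod_i ((a i)%:P + (b i)%:P * 'X) ^+ m i.

Lemma horner_line_poly f t : (line_poly f).[t] = f.@[fun i => a i + t * b i].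
Proof.
rewrite horner_sum mevalE; apply: eq_bigr => m _.
rewrite hornerZ horner_prod; congr (_ * _); apply: eq_bigr => i _.
by rewrite !hornerE mulrC.
Qed.

(** Here [d] and [e] only bound the degrees. Top coefficients may vanish, as they do for a factor
    [a i + b i t] with [b i = 0]. *)
Lemma coef_top_mul (p q : {poly k}) d e :
    (size p <= d.+1)%N -> (size q <= e.+1)%N ->
  (size (p * q)%R <= (d + e).+1)%N /\ (p * q)`_(d + e) = p`_d * q`_e.
Proof.
move=> sp sq; split.
  apply: leq_trans (size_polyMleq _ _) _.
  by rewrite -ltnS; move: (leq_add sp sq); rewrite addSn addnS; case: (_ + _)%N.
have lt_d : (d < (d + e).+1)%N by rewrite ltnS leq_addr.
rewrite coefM (bigD1 (Ordinal lt_d)) //= addKn big1 ?addr0 // => i ne_id.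
case: (ltngtP i d) => [ltid|ltdi|eqid].
- rewrite [q`__]nth_default ?mulr0 //; apply: leq_trans sq _.
  by rewrite ltn_subRL ltn_add2r.
- by rewrite [p`__]nth_default ?mul0r //; apply: leq_trans sp _.
- by case/eqP: ne_id; apply/val_inj.
Qed.

Lemma line_poly_monom (m : 'X_{1..n}) :
  let P := \prod_i ((a i)%:P + (b i)%:P * 'X) ^+ m i in
  (size P <= (mdeg m).+1)%N /\ P`_(mdeg m) = \prod_i b i ^+ m i.
Proof.
rewrite mdegE /=.
elim/big_ind3: _ => [|d1 P1 c1 d2 P2 c2 [s1 e1] [s2 e2]|i _].
- by rewrite size_poly1 coef1.
- by rewrite -e1 -e2; apply: coef_top_mul.
elim: (m i) => [|e [IHs IHe]]; first by rewrite !expr0 size_poly1 coef1.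
have sL : (size ((a i)%:P + (b i)%:P * 'X)%R <= 2)%N.
  rewrite (leq_trans (size_polyD _ _)) // geq_max.
  rewrite (leq_trans (size_polyC_leq1 _)) //.
  rewrite (leq_trans (size_polyMleq _ _)) // size_polyX addn2 /= ltnS.
  exact: size_polyC_leq1.
have cL : ((a i)%:P + (b i)%:P * 'X)`_1 = b i.
  by rewrite coefD coefC coefMX coefC /= add0r.
have [sP cP] := coef_top_mul sL IHs.
by rewrite !exprS; split=> //; rewrite [LHS]cP cL IHe.
Qed.

(** The coefficient of [t ^ d] is the value of [f] at the point at infinity of the line, the one
    point that no parameter [t] reaches. *)
Lemma line_poly_homog f d : f \is d.-homog ->
  (size (line_poly f) <= d.+1)%N /\ (line_poly f)`_d = f.@[b].
Proof.
move=> /dhomogP homf; split.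
  rewrite (leq_trans (size_sum _ _ _)) //; apply/bigmax_leqP_seq => m mf _.
  apply: leq_trans (size_scale_leq _ _) _.
  by rewrite -(homf m mf); case: (line_poly_monom m).
rewrite coef_sum mevalE !big_seq; apply: eq_bigr => m mf.
by rewrite coefZ -(homf m mf); case: (line_poly_monom m) => _ /= ->.
Qed.

End LinePoly.

(** * Lines missing the origin *)

Section Lines.
Variables (k : fieldType) (V : vectType k).
Implicit Types x y z : V.

Lemma line_neq0 x y t : x != 0 -> y \notin <[x]>%VS -> x + t *: y != 0.
Proof.
move=> nzx; apply: contraNneq => /eqP; rewrite addr_eq0 => /eqP Dx.
have nzt : t != 0 by apply: contraNneq nzx => t0; rewrite Dx t0 scale0r oppr0.
by rewrite -[y](scalerK nzt) -[t *: y]opprK -Dx scalerN memvN memvZ ?memv_line.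
Qed.

Lemma notin_line_neq0 x y : y \notin <[x]>%VS -> y != 0.
Proof. by apply: contraNneq => ->; rewrite mem0v. Qed.

Lemma exists_notin_line x : (1 < \dim {:V})%N -> exists y, y \notin <[x]>%VS.
Proof.
move=> dimV; have /subvPn[y _ ynx] : ~~ ({:V} <= <[x]>)%VS.
  apply/negP => /dimvS; rewrite leqNgt (leq_ltn_trans _ dimV) //.
  by rewrite dim_vline leq_b1.
by exists y.
Qed.

(** When [y] lies on the line spanned by [x], a vector [z] off that line serves as a detour; it
    exists because the dimension exceeds 1. *)
Lemma nonzero_connected (R : V -> V -> Prop) : (1 < \dim {:V})%N ->
    (forall x y, x != 0 -> y \notin <[x]>%VS -> R x y) ->
    (forall x y z, R x y -> R y z -> R x z) ->
  forall x y, x != 0 -> y != 0 -> R x y.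
Proof.
move=> dimV Rind Rtrans x y nzx nzy.
have [yx|] := boolP (y \in <[x]>%VS); last exact: Rind.
have [z zx] := exists_notin_line x dimV.
apply: (Rtrans x z y); first exact: Rind.
apply: Rind (notin_line_neq0 zx) _; apply: contra zx => /vlineP[c Dy].
have nzc : c != 0 by apply: contraNneq nzy => c0; rewrite Dy c0 scale0r.
by rewrite -[z](scalerK nzc) -Dy memvZ.
Qed.

End Lines.

(** * Tuples of forms without common zero *)

Section PolyEval.
Variables (k : closedFieldType) (V W : vectType k).
Implicit Types (x y : V) (f g : 'I_(\dim {:W}) -> {mpoly k[\dim {:V}]}).

Local Notation coords x := (fun l => coord (vbasis {:V}) l x).
Local Notation on_line x y := (line_poly (coords x) (coords y)).

Definition nowhere0 f := forall x, x != 0 -> poly_eval f x != 0.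

Lemma coord_poly_eval f x i :
  coord (vbasis {:W}) i (poly_eval f x) = (f i).@[coords x].
Proof. by rewrite coord_sum_free // (basis_free (vbasisP _)). Qed.

Lemma poly_eval_eqP f x w :
  (forall i, (f i).@[coords x] = coord (vbasis {:W}) i w) <-> poly_eval f x = w.
Proof.
split=> [E|<- i]; last by rewrite coord_poly_eval.
rewrite [RHS](coord_vbasis (memvf w)); apply: eq_bigr => i _.
by rewrite E.
Qed.

Lemma poly_eval_neq0 f x :
  poly_eval f x != 0 -> exists i, (f i).@[coords x] != 0.
Proof.
move=> nzf; apply/existsP; apply: contraNT nzf; rewrite negb_exists.
move=> /forallP f0; apply/eqP/poly_eval_eqP => i; rewrite linear0.
by apply/eqP/negPn.
Qed.

Lemma horner_on_line h x y t : (on_line x y h).[t] = h.@[coords (x + t *: y)].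
Proof.
by rewrite horner_line_poly; apply: meval_eq => i; rewrite linearD linearZ.
Qed.

(** All points of the line are non-zero, so [proportional_poly] applies. As [f] does not vanish at
    the direction [y], some [f i] keeps degree exactly [d] on the line, and this bounds the degree
    of the factor by [e - d]. *)
Lemma proportional_on_line f g d e x y :
    (forall i, f i \is d.-homog) -> (forall i, g i \is e.-homog) ->
    nowhere0 f ->
    (forall z, z != 0 -> exists c, poly_eval g z = c *: poly_eval f z) ->
    x != 0 -> y \notin <[x]>%VS ->
  exists2 c : {poly k}, c != 0 -> (size c + d <= e.+1)%N &
    forall i, on_line x y (g i) = c * on_line x y (f i).
Proof.
move=> homf homg f0 gf nzx nxy.
have [||c Dc] := @proportional_poly _ _ (fun i => on_line x y (f i))
                                        (fun i => on_line x y (g i)).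
- move=> t; have [i fi] := poly_eval_neq0 (f0 _ (line_neq0 t nzx nxy)).
  by exists i; rewrite horner_on_line.
- move=> t; have [c Dc] := gf _ (line_neq0 t nzx nxy); exists c => i.
  by rewrite !horner_on_line -!coord_poly_eval Dc linearZ.
exists c => // nzc.
have [i fi] := poly_eval_neq0 (f0 _ (notin_line_neq0 nxy)).
have [sf cf] := line_poly_homog (coords x) (coords y) (homf i).
have [sg _] := line_poly_homog (coords x) (coords y) (homg i).
have nzf : on_line x y (f i) != 0.
  by apply: contraNneq fi => f_0; rewrite -cf f_0 coef0.
have sfd : size (on_line x y (f i)) = d.+1.
  apply/anti_leq; rewrite sf ltnNge /=; apply: contraNN fi => le_d.
  by rewrite -cf nth_default.
by move: sg; rewrite Dc size_mul // sfd addnS.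
Qed.

(** On a single line missing the origin, the factor is non-zero because [g] has no zero there; its
    degree bound then compares [d] and [e]. *)
Lemma homog_degree_le f g d e : (1 < \dim {:V})%N ->
    (forall i, f i \is d.-homog) -> (forall i, g i \is e.-homog) ->
    nowhere0 f -> nowhere0 g ->
    (forall z, z != 0 -> exists c, poly_eval g z = c *: poly_eval f z) ->
  (d <= e)%N.
Proof.
move=> dimV homf homg f0 g0 gf.
have [x /notin_line_neq0 nzx] := exists_notin_line 0 dimV.
have [y nxy] := exists_notin_line x dimV.
have [c le_c Dc] := proportional_on_line homf homg f0 gf nzx nxy.
have nzc : c != 0.
  have [i] := poly_eval_neq0 (g0 _ (line_neq0 0 nzx nxy)).
  rewrite -horner_on_line Dc; apply: contraNneq => ->.
  by rewrite mul0r horner0.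
have := le_c nzc; move: nzc; rewrite -size_poly_gt0.
by case: (size c) => // s _; rewrite addSn ltnS; apply: leq_trans (leq_addl _ _).
Qed.

(** With equal degrees, the factor on the line from [x] in direction [y] is a constant. Evaluation
    at [t = 0], where [g] vanishes but [f] does not, shows that it is 0. So [g] vanishes along the
    line and at its point at infinity [y]. *)
Lemma homog_eq_degree_zeros f g d : (1 < \dim {:V})%N ->
    (forall i, f i \is d.-homog) -> (forall i, g i \is d.-homog) ->
    nowhere0 f ->
    (forall z, z != 0 -> exists c, poly_eval g z = c *: poly_eval f z) ->
  forall x y, x != 0 -> y != 0 -> poly_eval g x = 0 -> poly_eval g y = 0.
Proof.
move=> dimV homf homg f0 gf; apply: nonzero_connected => //; last first.
  by move=> x y z gxy gyz /gxy.
move=> x y nzx nxy gx0.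
have [c le_c Dc] := proportional_on_line homf homg f0 gf nzx nxy.
have c0 : c = 0.
  apply/eqP/negPn/negP => nzc.
  have /size_poly1P[a nza Da] : size c == 1%N.
    by rewrite eqn_leq size_poly_gt0 nzc andbT -(leq_add2r d) add1n le_c.
  have [i] := poly_eval_neq0 (f0 _ (line_neq0 0 nzx nxy)).
  rewrite -horner_on_line => /negP; apply.
  rewrite -[_ == 0]orFb -(negPf nza) -mulf_eq0.
  have := Dc i; rewrite Da mul_polyC => /(congr1 (horner^~ 0)) /=.
  rewrite hornerZ => <-; rewrite horner_on_line scale0r addr0.
  by rewrite -coord_poly_eval gx0 linear0.
apply/poly_eval_eqP => i; rewrite linear0.
have [_ <-] := line_poly_homog (coords x) (coords y) (homg i).
by rewrite Dc c0 mul0r coef0.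
Qed.

Lemma exists_coords (v : 'I_(\dim {:V}) -> k) :
  exists x, (fun l => coord (vbasis {:V}) l x) =1 v.
Proof.
exists (\sum_i v i *: (vbasis {:V})`_i) => l.
by rewrite coord_sum_free // (basis_free (vbasisP _)).
Qed.

(* A common divisor has no zero off the origin, hence is constant on every
   line missing the origin. *)
Lemma nowhere0_gcd1 f : (1 < \dim {:V})%N -> nowhere0 f -> gcd1 f.
Proof.
move=> dimV f0 h hf.
have h0 x : x != 0 -> h.@[coords x] != 0.
  move=> /f0/poly_eval_neq0[i]; have [q ->] := hf i.
  by rewrite mevalM mulf_eq0 negb_or => /andP[].
have hE x y : x != 0 -> y != 0 -> h.@[coords x] = h.@[coords y].
  move: x y; apply: nonzero_connected => // [x y nzx nxy|x y z -> //].
  have nyx : y - x \notin <[x]>%VS by rewrite rpredBr ?memv_line.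
  have [t|c Dc] := @no_root_polyC _ (on_line x (y - x) h).
    by rewrite horner_on_line h0 ?line_neq0.
  have := horner_on_line h x (y - x) 0; have := horner_on_line h x (y - x) 1.
  by rewrite Dc !hornerC scale1r scale0r addr0 addrC subrK => <- <-.
have [x0 /notin_line_neq0 nzx0] := exists_notin_line 0 dimV.
pose i0 : 'I_(\dim {:V}) := Ordinal (ltnW dimV).
pose c := h.@[coords x0].
(* Off the origin [h] takes the value [c]; the factor ['X_i0] kills the remaining point. *)
have : (h - c%:MP) * 'X_i0 = 0.
  apply: meval_eq0_mpoly => v; have [x Dx] := exists_coords v.
  rewrite -(meval_eq _ Dx) mevalM mevalB mevalC mevalXU.
  have [->|nzx] := eqVneq x 0; first by rewrite linear0 mulr0.
  by rewrite (hE x x0) // subrr mul0r.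
move=> /eqP; rewrite mulf_eq0 subr_eq0 => /orP[/eqP ->|/eqP X0].
  by apply: rmorph_unit; rewrite unitfE h0.
have := congr1 (meval (fun=> 1)) X0.
by rewrite mevalXU meval0 => /eqP; rewrite oner_eq0.
Qed.

End PolyEval.

(** * Functions given by forms, and wedges of powers of an operator *)

Section Forms.
Variables (k : fieldType) (V : vectType k).
Implicit Types (phi psi : V -> k) (d e : nat).

(** The notion is attached to functions, so that homogeneity can be proved by following the
    expression in [x], without handling the polynomial. *)
Definition is_form d phi :=
  exists2 f : {mpoly k[\dim {:V}]}, f \is d.-homog
    & forall x, f.@[fun l => coord (vbasis {:V}) l x] = phi x.

Lemma form_ext d phi psi : phi =1 psi -> is_form d phi -> is_form d psi.
Proof. by move=> E [f homf Df]; exists f => // x; rewrite Df E. Qed.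

Lemma form_const c : is_form 0 (fun=> c).
Proof.
exists (c *: 1) => [|x]; first by rewrite dhomogZ ?dhomog1.
by rewrite mevalZ meval1 mulr1.
Qed.

Lemma form0 d : is_form d (fun=> 0).
Proof. by exists 0 => [|x]; rewrite ?dhomog0 ?meval0. Qed.

Lemma formD d phi psi :
  is_form d phi -> is_form d psi -> is_form d (fun x => phi x + psi x).
Proof.
move=> [f homf Df] [h homh Dh]; exists (f + h); first exact: dhomogD.
by move=> x; rewrite mevalD Df Dh.
Qed.

Lemma formM d e phi psi :
  is_form d phi -> is_form e psi -> is_form (d + e) (fun x => phi x * psi x).
Proof.
move=> [f homf Df] [h homh Dh]; exists (f * h); first exact: dhomogM.
by move=> x; rewrite mevalM Df Dh.
Qed.

Lemma formZ d c phi : is_form d phi -> is_form d (fun x => c * phi x).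
Proof. exact: (formM (form_const c)). Qed.

Lemma form_sum d (I : Type) (r : seq I) (P : pred I) (phi : I -> V -> k) :
    (forall i, P i -> is_form d (phi i)) ->
  is_form d (fun x => \sum_(i <- r | P i) phi i x).
Proof.
move=> F; elim: r => [|i r IHr].
  by apply: form_ext (form0 d) => x; rewrite big_nil.
have [Pi|nPi] := boolP (P i); last first.
  by apply: form_ext IHr => x; rewrite big_cons (negPf nPi).
by apply: form_ext (formD (F i Pi) IHr) => x; rewrite big_cons Pi.
Qed.

Lemma form_prod d n (phi : 'I_n -> V -> k) :
  (forall i, is_form d (phi i)) -> is_form (d * n) (fun x => \prod_i phi i x).
Proof.
elim: n phi => [|n IHn] phi F.
  by rewrite muln0; apply: form_ext (form_const 1) => x; rewrite big_ord0.
rewrite mulnS; have Fl := IHn (fun i => phi (lift ord0 i)) (fun i => F _).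
by apply: form_ext (formM (F ord0) Fl) => x; rewrite big_ord_recl.
Qed.

Lemma form_det d n (A : V -> 'M[k]_n) :
  (forall a b, is_form d (fun x => A x a b)) ->
  is_form (d * n) (fun x => \det (A x)).
Proof. by move=> F; apply: form_sum => s _; apply/formZ/form_prod. Qed.

Lemma form_linear phi : scalar phi -> is_form 1 phi.
Proof.
move=> lin; pose B := GRing.isLinear.Build _ _ _ _ phi lin.
pose L : {scalar V} := HB.pack phi B.
apply: (@form_ext _ (fun x =>
  \sum_(i < \dim {:V}) phi (vbasis {:V})`_i * coord (vbasis {:V}) i x)) => [x|].
  rewrite -[phi x]/(L x) {2}(coord_vbasis (memvf x)) linear_sum; apply: eq_bigr => i _.
  by rewrite linearZ mulrC.
apply: form_sum => i _; apply: formZ; exists 'X_i => [|x]; last by rewrite mevalXU.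
by rewrite dhomogX; apply/eqP/mdeg1.
Qed.

Section PowForms.
Variables (M : vectType k) (T : {linear V -> 'End(M)}).
Local Notation pow x j := (iter j (fun f => (T x \o f)%VF) \1%VF).

(** Each further application of [T x] multiplies the coordinate vector by a matrix whose entries are
    linear forms in [x]. *)
Lemma form_coord_pow j i (v : M) :
  is_form j (fun x => coord (vbasis {:M}) i (pow x j v)).
Proof.
elim: j i => [|j IHj] i.
  by apply: form_ext (form_const _) => x; rewrite /= id_lfunE.
pose e := vbasis {:M}.
apply: (@form_ext _ (fun x =>
  \sum_(l < \dim {:M}) coord e i (T x e`_l) * coord e l (pow x j v))) => [x|].
  rewrite /= comp_lfunE [in RHS](coord_vbasis (memvf (pow x j v))).
  rewrite !linear_sum; apply: eq_bigr => l _.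
  by rewrite !linearZ /= mulrC.
apply: form_sum => l _; rewrite -add1n; apply: formM => //.
apply: form_linear => c x y.
by rewrite linearP add_lfunE scale_lfunE linearP.
Qed.

Lemma wedge_pow_forms d j (v : 'I_d -> M) :
  exists2 f : 'I_(\dim {: extpow M d}) -> {mpoly k[\dim {:V}]},
    forall i, f i \is (j * d).-homog
    & forall x, poly_eval f x = wedge (fun a => pow x j (v a)).
Proof.
pose e := vbasis {: extpow M d}.
pose w x := wedge (fun a => pow x j (v a)).
have F i : is_form (j * d) (fun x => coord e i (w x)).
  (* The minors [w x I] are coordinates in the standard basis [delta], whereas [poly_eval] refers to
     [vbasis]. The change of basis has constant coefficients and so preserves the degree. *)
  pose delta I : extpow M d := [ffun J => (J == I)%:R].
  apply: (@form_ext _ (fun x => \sum_I coord e i (delta I) * w x I)) => [x|].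
    rewrite [in RHS](_ : w x = \sum_I w x I *: delta I).
      by rewrite linear_sum; apply: eq_bigr => I _; rewrite linearZ /= mulrC.
    apply/ffunP => J; rewrite sum_ffunE (bigD1 J) //= big1 => [|I neIJ].
      by rewrite addr0 !ffunE eqxx /GRing.scale /= mulr1.
    by rewrite !ffunE eq_sym (negPf neIJ) /GRing.scale /= mulr0.
  apply: form_sum => I _; apply: formZ.
  apply: (@form_ext _ (fun x => \det (\matrix_(a < d, b < d)
     coord (vbasis {:M}) (subset_nth I b) (pow x j (v a))))) => [x|].
    by rewrite ffunE.
  apply: form_det => a b; apply: form_ext (form_coord_pow j _ (v a)) => x.
  by rewrite mxE.
have /choice[f Df] : forall i, exists f : {mpoly k[\dim {:V}]},
    f \is (j * d).-homog
    /\ forall x, f.@[fun l => coord (vbasis {:V}) l x] = coord e i (w x).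
  by move=> i; have [f homf Df] := F i; exists f.
exists f => [i|x]; first by case: (Df i).
rewrite [RHS](coord_vbasis (memvf _)); apply: eq_bigr => i _.
by case: (Df i) => _ ->.
Qed.

End PowForms.
End Forms.

(** * Wedges and Pluecker lines *)

Section Wedge.
Variables (k : fieldType) (M : vectType k).
Implicit Types (U : {vspace M}).

Definition lin_indep d (w : 'I_d -> M) :=
  forall r : 'I_d -> k, \sum_a r a *: w a = 0 -> forall a, r a = 0.

Lemma dim_basis_fun d U : \dim U = d ->
  exists v : 'I_d -> M, [/\ forall a, v a \in U, lin_indep v &
    forall u, u \in U -> exists r : 'I_d -> k, u = \sum_a r a *: v a].
Proof.
move=> <-; exists (fun a => (vbasis U)`_a); split=> [a||u uU].
- by rewrite vbasis_mem // mem_nth // size_tuple.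
- exact/freeP/(basis_free (vbasisP U)).
- by exists (fun a => coord (vbasis U) a u); apply: coord_vbasis.
Qed.

Lemma wedge_mulmx d (C : 'M[k]_d) (u w : 'I_d -> M) :
  (forall a, w a = \sum_b C a b *: u b) -> wedge w = \det C *: wedge u.
Proof.
move=> Dw; apply/ffunP => I; rewrite !ffunE /GRing.scale /= -det_mulmx.
congr (\det _); apply/matrixP => a b; rewrite !mxE Dw linear_sum.
by apply: eq_bigr => l _; rewrite linearZ mxE.
Qed.

Lemma wedge_eq0_row d (w : 'I_d -> M) a : w a = 0 -> wedge w = 0.
Proof.
move=> wa0; apply/ffunP => I; rewrite !ffunE (expand_det_row _ a) big1 // => b _.
by rewrite mxE wa0 linear0 mul0r.
Qed.

(** [C] holds the coordinates of the [w a] in the basis of [U]; a row vector killed by [C] would be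
    a linear relation between the [w a]. *)
Lemma wedge_in_det d (U : Gr M d) (w : 'I_d -> M) : (forall a, w a \in sval U) ->
  exists2 C : 'M[k]_d,
    wedge w = \det C *: wedge (fun a : 'I_d => (vbasis (sval U))`_a) &
    lin_indep w -> \det C != 0.
Proof.
case: U => U /= dimU; move: w; move: (dimU) => /eqP dU; subst d => w wU.
pose C := \matrix_(a, b) coord (vbasis U) b (w a).
have Dw a : w a = \sum_b C a b *: (vbasis U)`_b.
  by rewrite {1}(coord_vbasis (wU a)); apply: eq_bigr => b _; rewrite mxE.
exists C => [|indw]; first exact: wedge_mulmx.
rewrite -unitfE -unitmxE -row_free_unit -kermx_eq0.
apply/rowV0P => r /sub_kermxP rC; apply/rowP => a; rewrite mxE.
apply: indw; under eq_bigr do rewrite Dw scaler_sumr.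
rewrite exchange_big big1 //= => b _.
under eq_bigr do rewrite scalerA.
have rCb : \sum_a r 0 a * C a b = 0 by move/rowP/(_ b): rC; rewrite !mxE.
by rewrite -scaler_suml rCb scale0r.
Qed.

Lemma wedge_in_plucker d (U : Gr M d) (w : 'I_d -> M) :
  (forall a, w a \in sval U) -> wedge w \in sval (plucker U).
Proof. by move=> /wedge_in_det[C -> _]; rewrite /= memvZ ?memv_line. Qed.

Lemma wedge_indep_neq0 d (U : Gr M d) (w : 'I_d -> M) :
  (forall a, w a \in sval U) -> lin_indep w -> wedge w != 0.
Proof.
move=> /wedge_in_det[C -> detC] /detC nzC.
by rewrite scaler_eq0 (negPf nzC) wedge_neq0.
Qed.

Lemma dim1_vline (L : {vspace M}) v :
  \dim L = 1%N -> v \in L -> v != 0 -> L = <[v]>%VS.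
Proof.
move=> dL vL nzv; apply/esym/eqP; rewrite eqEdim dL dim_vline nzv andbT.
by rewrite -memvE.
Qed.

End Wedge.

(** * Uniqueness of the degree of a morphism defined everywhere *)

Section DegreeUniqueness.
Variables (k : closedFieldType) (V W : vectType k) (U : pred (PP V)).
Variable phi : {L : PP V | U L} -> PP W.
Hypothesis dimV : (1 < \dim {:V})%N.
Hypothesis U_total :
  forall x : V, x != 0 -> exists L : {L : PP V | U L}, x \in sval (sval L).

(** The value of [phi] is a line, so a vector spanning it cannot be 0. *)
Lemma has_degree_nowhere0 (f : 'I_(\dim {:W}) -> {mpoly k[\dim {:V}]}) :
    (forall (L : {L : PP V | U L}) x, x \in sval (sval L) -> x != 0 ->
       sval (phi L) = <[poly_eval f x]>%VS) ->
  nowhere0 f.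
Proof.
move=> Df x nzx; have [L xL] := U_total nzx.
by have := svalP (phi L); rewrite (Df L x) // dim_vline; case: (_ != 0).
Qed.

Lemma has_degree_le d e : has_degree phi d -> has_degree phi e -> (d <= e)%N.
Proof.
move=> [f [homf _ Df]] [h [homh _ Dh]].
apply: (homog_degree_le dimV homf homh); try exact: has_degree_nowhere0.
move=> z nzz; have [L zL] := U_total nzz; apply/vlineP.
by rewrite -(Df L) // (Dh L z) // memv_line.
Qed.

Lemma morph_degreeE d : has_degree phi d -> morph_degree phi = d.
Proof.
move=> hd; rewrite /morph_degree; case: pselect => [h|[]]; last by exists d.
by case: (cid h) => e he /=; apply/anti_leq; rewrite !has_degree_le.
Qed.

End DegreeUniqueness.

(** * Linearity of the action, scaling and ranks *)

Section RestrictedAction.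
Variables (k : fieldType) (p : nat) (g : restrLieAlg k p).

Lemma env_iota_linear : linear (@env_iota k g).
Proof.
move=> c x y.
transitivity (quot_pi (@env_proper k g) (c *: free_gen x + free_gen y)).
  apply/quot_piE/asboolP; rewrite -[X in ideal_gen _ X]mulr1 -[X in X * 1]mul1r.
  exact/IdealGenM/EnvLinear.
by rewrite quot_piD quot_piZ.
Qed.

Lemma restr_iota_linear : linear (@restr_iota k p g).
Proof.
by move=> c x y; rewrite /restr_iota env_iota_linear quot_piD quot_piZ.
Qed.

HB.instance Definition _ := GRing.isLinear.Build k g (restricted_env g) _
  (@restr_iota k p g) restr_iota_linear.

Variables (V : {vspace g}) (M : fdModule (restricted_env g)).

HB.instance Definition _ := GRing.isLinear.Build k (restricted_env g) 'End(M) _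
  (@mod_act k _ M) (@mod_act_linear k _ M).

Definition subvs_act (x : subvs_of V) : 'End(M) :=
  mod_act M (restr_iota (vsval x)).

Lemma subvs_act_linear : linear subvs_act.
Proof.
by move=> c x y; rewrite /subvs_act !linearP.
Qed.

HB.instance Definition _ :=
  GRing.isLinear.Build k (subvs_of V) 'End(M) _ subvs_act subvs_act_linear.

Lemma mod_act_iotaZ c x :
  mod_act M (restr_iota (c *: x)) = c *: mod_act M (restr_iota x).
Proof.
by rewrite !linearZ.
Qed.

Lemma op_powZ c x j : op_pow M (c *: x) j = c ^+ j *: op_pow M x j.
Proof.
elim: j => [|j IHj]; first by rewrite expr0 scale1r.
rewrite /= -/(op_pow M _ j) IHj mod_act_iotaZ exprS.
by rewrite -comp_lfunZl -comp_lfunZr scalerA.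
Qed.

Lemma limg_op_powZ c x j : c != 0 ->
  limg (op_pow M (c *: x) j) = limg (op_pow M x j).
Proof.
move=> nzc; have nzcj : c ^+ j != 0 by rewrite expf_neq0.
apply/vspaceP => u; apply/memv_imgP/memv_imgP => -[v _ ->].
  by exists (c ^+ j *: v); rewrite ?memvf // op_powZ scale_lfunE linearZ.
exists ((c ^+ j)^-1 *: v); rewrite ?memvf // op_powZ scale_lfunE linearZ.
by rewrite scalerA divff ?scale1r.
Qed.

Lemma op_rank0 j : (0 < j)%N -> op_rank M 0 j = 0%N.
Proof.
case: j => // j _; rewrite /op_rank -[X in op_pow M X](scale0r (0 : g)) op_powZ.
rewrite expr0n scale0r; apply/eqP; rewrite dimv_eq0 -subv0.
by apply/subvP => u /memv_imgP[v _ ->]; rewrite zero_lfunE mem0v.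
Qed.

Lemma op_rank_le_generic x j :
  x \in nullcone (g := g) -> (op_rank M x j <= generic_rank M j)%N.
Proof.
move=> nx; have lt_r : (op_rank M x j < (\dim {:M}).+1)%N.
  by rewrite ltnS dimvS ?subvf.
rewrite /generic_rank.
by apply: (leq_bigmax_cond (Ordinal lt_r)); apply/asboolP; exists x.
Qed.

Lemma generic_rankE j x : (0 < j)%N -> constant_rank M j ->
  x \in nullcone (g := g) -> x != 0 -> generic_rank M j = op_rank M x j.
Proof.
move=> j0 cM nx nzx; apply/anti_leq; rewrite op_rank_le_generic // andbT.
apply/bigmax_leqP => r /asboolP[y ny <-].
(* The maximum also ranges over 0, which [constant_rank] does not control; its rank is 0 because [j]
   is positive. *)
have [->|nzy] := eqVneq y 0; first by rewrite op_rank0.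
by rewrite (cM y x).
Qed.

Lemma generic_rank_gt0 j : (0 < j)%N -> (0 < generic_rank M j)%N ->
  exists2 x, x \in nullcone (g := g) & x != 0.
Proof.
move=> j0; rewrite lt0n => nz; apply: contrapT => nox; case/eqP: nz.
apply/eqP; rewrite -leqn0; apply/bigmax_leqP => r /asboolP[y ny <-].
have [->|nzy] := eqVneq y 0; first by rewrite op_rank0.
by case: nox; exists y.
Qed.

Lemma generic_rank0_equal_kernels j :
  generic_rank M j = 0%N -> equal_kernels M j.
Proof.
move=> r0; exists fullv => x nx _; apply/vspaceP => u.
rewrite memvf memv_ker -memv0.
suff <- : limg (op_pow M x j) = 0%VS by rewrite memv_img ?memvf.
apply/eqP; rewrite -dimv_eq0 -leqn0 -r0; exact: op_rank_le_generic.
Qed.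

End RestrictedAction.

(** * The Pluecker map of a module of constant rank *)

Section ConstantRank.
Variables (k : closedFieldType) (p : nat) (g : restrLieAlg k p).
Variables (V : {vspace g}) (M : fdModule (restricted_env g)) (j : nat).
Hypothesis VE : forall x : g, (x \in V) = (x \in nullcone (g := g)).
Hypotheses (dimV : (1 < \dim V)%N) (j_gt0 : (0 < j)%N).
Hypothesis crM : constant_rank M j.

Local Notation d := (generic_rank M j).
Local Notation pow x := (op_pow M (vsval x) j).
Local Notation phi := (fun L => plucker (@im_map k p g V M j L)).

Lemma dim_subvs_gt1 : (1 < \dim {: subvs_of V})%N.
Proof. by rewrite dimvf. Qed.

Lemma vsval_neq0 (x : subvs_of V) : x != 0 -> vsval x != 0.
Proof. by apply: contraNneq => x0; apply/eqP/subvs_inj; rewrite x0 linear0. Qed.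

Lemma dim_limg_pow (x : subvs_of V) : x != 0 -> \dim (limg (pow x)) = d.
Proof.
move=> nzx; symmetry; apply: generic_rankE => //.
by rewrite -VE subvsP.
Qed.

Definition pow_Gr (x : subvs_of V) (nzx : x != 0) : Gr M d :=
  exist (fun W : {vspace M} => \dim W == d) _ (introT eqP (dim_limg_pow nzx)).

(** The map reads the image at [vpick L], which is a non-zero multiple of [x]; scaling does not
    change the image. *)
Lemma plucker_im_mapE (L : {L | max_locus M j L}) (x : subvs_of V)
    (nzx : x != 0) : x \in sval (sval L) ->
  sval (phi L) = sval (plucker (pow_Gr nzx)).
Proof.
move=> xL; rewrite /= /line_im; case: L xL => -[L /= dL] /= _ xL.
have DL := dim1_vline (eqP dL) xL nzx.
have /vlineP[c Dc] : vpick L \in <[x]>%VS by rewrite -DL memv_pick.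
have nzc : c != 0.
  have : vpick L != 0 by rewrite vpick0 DL -dimv_eq0 dim_vline nzx.
  by apply: contraNneq => c0; rewrite Dc c0 scale0r.
by rewrite Dc linearZ limg_op_powZ.
Qed.

Lemma max_locus_total (x : subvs_of V) : x != 0 ->
  exists L : {L | max_locus M j L}, x \in sval (sval L).
Proof.
move=> nzx; have dL : \dim <[x]>%VS == 1%N by rewrite dim_vline nzx.
have ULx : max_locus M j (exist (fun L : {vspace subvs_of V} => \dim L == 1%N) _ dL).
  rewrite /max_locus /line_im dim_limg_pow // vpick0 -dimv_eq0.
  by rewrite (eqP dL).
by exists (exist (fun L => max_locus M j L) _ ULx); rewrite memv_line.
Qed.

Lemma wedge_pow_plucker (x : subvs_of V) (nzx : x != 0) (v : 'I_d -> M) :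
  wedge (fun a => pow x (v a)) \in sval (plucker (pow_Gr nzx)).
Proof. by apply: wedge_in_plucker => a; rewrite memv_img ?memvf. Qed.

Lemma wedge_pow_homog (v : 'I_d -> M) :
  exists2 f : 'I_(\dim {: extpow M d}) -> {mpoly k[\dim {: subvs_of V}]},
    forall i, f i \is (j * d).-homog
    & forall x, poly_eval f x = wedge (fun a => pow x (v a)).
Proof.
have [f homf Df] := wedge_pow_forms (@subvs_act k p g V M) j v.
by exists f => // x; rewrite Df.
Qed.

Lemma equal_kernels_degree : equal_kernels M j -> has_degree phi (j * d).
Proof.
move=> [W kerW].
have [x0 /notin_line_neq0 nzx0] := exists_notin_line 0 dim_subvs_gt1.
have kerE (x : subvs_of V) : x != 0 -> lker (pow x) = W.
  by move=> nzx; apply: kerW; [rewrite -VE subvsP | apply: vsval_neq0].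
(* Rank-nullity at one non-zero [x0]. *)
have dimW : \dim W^C = d.
  rewrite dimv_compl -(dim_limg_pow nzx0) -(kerE _ nzx0).
  by rewrite -(limg_ker_dim (pow x0) fullv) capfv addKn.
have [v [vW indv _]] := dim_basis_fun dimW.
(* A relation between the images puts a combination of the [v a] into the kernel [W], which meets
   [W^C] in 0. *)
have indp (x : subvs_of V) : x != 0 -> lin_indep (fun a => pow x (v a)).
  move=> nzx r r0; apply: indv; apply/eqP; rewrite -memv0 -(capv_compl W).
  rewrite memv_cap; apply/andP; split; last first.
    by apply: memv_suml => a _; apply: memvZ.
  rewrite -(kerE x nzx) memv_ker linear_sum; apply/eqP.
  by rewrite -[RHS]r0; apply: eq_bigr => a _; rewrite linearZ.
have [f homf Df] := wedge_pow_homog v.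
have f0 : nowhere0 f.
  move=> x nzx; rewrite Df; apply: (wedge_indep_neq0 (U := pow_Gr nzx)) => //.
    by move=> a; rewrite memv_img ?memvf.
  exact: indp.
exists f; split=> // [|L x xL nzx]; first exact: nowhere0_gcd1 dim_subvs_gt1 f0.
rewrite (plucker_im_mapE nzx xL); apply: dim1_vline (f0 x nzx).
  exact/eqP/plucker_subproof.
by rewrite Df; apply: wedge_pow_plucker.
Qed.

(** The wedge is given by forms of the same degree as [f] and lies on the line spanned by [f], so
    [homog_eq_degree_zeros] applies. *)
Lemma degree_wedge_zeros (v : 'I_d -> M) (x y : subvs_of V) :
    has_degree phi (j * d) -> x != 0 -> y != 0 ->
  wedge (fun a => pow x (v a)) = 0 -> wedge (fun a => pow y (v a)) = 0.
Proof.
move=> [f [homf _ Df]] nzx nzy.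
have [h homh Dh] := wedge_pow_homog v.
have f0 := has_degree_nowhere0 max_locus_total Df.
rewrite -!Dh; apply: (homog_eq_degree_zeros dim_subvs_gt1 homf homh f0) => //.
move=> z nzz; have [L zL] := max_locus_total nzz; apply/vlineP.
rewrite -(Df L z zL nzz) (plucker_im_mapE nzz zL) Dh.
exact: wedge_pow_plucker.
Qed.

(** Suppose [x] kills [u] but the image of [u] under [y] has a non-zero coordinate at [a0]. By
    exchange, that image replaces [b a0] in the basis [b]. Lifting this new basis through [y], with
    [u] as lift at [a0], gives a wedge that vanishes at [x] and not at [y], a contradiction. *)
Lemma degree_ker_sub (x y : subvs_of V) :
    has_degree phi (j * d) -> x != 0 -> y != 0 ->
  (lker (pow x) <= lker (pow y))%VS.
Proof.
move=> hd nzx nzy; apply/subvP => u; rewrite !memv_ker => /eqP xu0.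
have [b [bim indb spanb]] := dim_basis_fun (dim_limg_pow nzy).
have [r Dr] := spanb (pow y u) (memv_img _ (memvf _)).
rewrite Dr; apply/eqP/big1 => a0 _; have [->|nzr] := eqVneq (r a0) 0.
  by rewrite scale0r.
pose v a := if a == a0 then u else ((pow y)^-1)%VF (b a).
suff : wedge (fun a => pow y (v a)) != 0.
  rewrite (degree_wedge_zeros hd nzx nzy) ?eqxx //.
  by apply: (@wedge_eq0_row _ _ _ _ a0); rewrite /v eqxx.
apply: (wedge_indep_neq0 (U := pow_Gr nzy)) => [a|s].
  by rewrite memv_img ?memvf.
(* The relation rewritten in the basis [b]: its coordinate at [a0] is [s a0 * r a0], which gives
   [s a0 = 0], and then the other coordinates are the [s a]. *)
have Ds : \sum_a s a *: pow y (v a)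
    = \sum_a (s a0 * r a + (if a == a0 then 0 else s a)) *: b a.
  rewrite (bigD1 a0) //= {1}/v eqxx Dr scaler_sumr.
  under [RHS]eq_bigr do rewrite scalerDl -scalerA.
  rewrite big_split /=; congr (_ + _).
  rewrite [RHS](bigD1 a0) //= eqxx scale0r add0r; apply: eq_bigr => a ne.
  by rewrite /v (negPf ne) limg_lfunVK.
rewrite Ds => /indb s0.
have sa0 : s a0 = 0.
  by have /eqP := s0 a0; rewrite eqxx addr0 mulf_eq0 (negPf nzr) orbF => /eqP.
move=> a; have := s0 a; rewrite sa0 mul0r add0r.
by case: eqP => // ->.
Qed.

Lemma degree_equal_kernels : has_degree phi (j * d) -> equal_kernels M j.
Proof.
move=> hd; have [x0 /notin_line_neq0 nzx0] := exists_notin_line 0 dim_subvs_gt1.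
exists (lker (pow x0)) => x; rewrite -VE => xV nzx.
have Dx := vsprojK xV; have nzpx : vsproj V x != 0.
  by apply: contraNneq nzx => px0; rewrite -Dx px0 linear0.
by rewrite -Dx; apply/eqP; rewrite eqEsubv !degree_ker_sub.
Qed.

End ConstantRank.

(** The hypothesis [hdim] excludes the case where P(V) is a point: the kernels then agree by scaling
    and the degree is 0, while the right-hand side is positive as soon as the rank is. If [V] is
    zero, so is the rank. *)
Theorem corollary4p2p3 (k : closedFieldType) (p : nat) (hp : p \in [pchar k])
    (g : restrLieAlg k p) (V : {vspace g})
    (hV : forall x : g, (x \in V) = (x \in nullcone (g := g)))
    (hdim : \dim V != 1%N)
    (j : nat) (hj : (0 < j < p)%N)
    (M : fdModule (restricted_env g)) (hM : constant_rank M j) :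
  equal_kernels M j <-> mod_degree V M j = (j * generic_rank M j)%N.
Proof.
have /andP[j_gt0 _] := hj; rewrite /mod_degree.
have [r0|r_neq0] := eqVneq (generic_rank M j) 0%N.
  rewrite r0 muln0; split=> // _; exact: generic_rank0_equal_kernels.
have dimV : (1 < \dim V)%N.
  have [||x nx nzx] := @generic_rank_gt0 _ _ _ M j; rewrite ?lt0n // -?lt0n //.
  rewrite ltn_neqAle eq_sym hdim lt0n dimv_eq0.
  by apply: contraNneq nzx => V0; rewrite -memv0 -V0 hV.
split=> [ek|].
  apply: morph_degreeE; first exact: dim_subvs_gt1.
    exact: max_locus_total.
  exact: equal_kernels_degree.
(* Without any degree, [morph_degree] would take its default value 0, which differs from a product
   of positive numbers. Hence the equality does yield representing forms. *)
rewrite /morph_degree; case: pselect => [ex|_ /esym/eqP]; last first.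
  by rewrite muln_eq0 (negPf r_neq0) orbF eqn0Ngt j_gt0.
case: (cid ex) => e /= he De; rewrite De in he.
exact: degree_equal_kernels he.
Qed.
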